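(* Let $n\ge2$ and $\alpha\in(\tfrac15,1]$. There is a constant $\alpha'>0$ depending only on $n$ and $\alpha$ such that the following holds. Let $0<\lambda\le\Lambda$ and let $u:\overline{B_1^+}\to\mathbb{R}$ be a convex, continuous solution to $$\det D^2u=f\ \text{ in }B_1^+,\qquad u=\varphi\ \text{ on }\partial B_1^+,$$ where $\lambda\le f\le\Lambda$ in $B_1^+$. Assume that $\varphi\in C^{1,\alpha}(0)$ with $$\varphi(0)=0,\qquad \nabla_{x'}\varphi(0)=0,$$ and that $\varphi$ separates quadratically from $0$ on $\partial B_1^+$ in a neighborhood of $\{x_n=0\}$, i.e. there are $\mu,\rho>0$ such that $$\varphi(x)\ge\mu|x|^2\qquad\text{for all }x\in\partial B_1^+\cap\{x_n\le\rho\}.$$ Then $u\in C^{1,\alpha'}(0)$.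
   Context: Points of $\mathbb{R}^n$ are written $x=(x',x_n)$ with $x'\in\mathbb{R}^{n-1}$; $B_1^+=\{x\in\mathbb{R}^n:|x|<1,\ x_n>0\}$. Solutions of $\det D^2u=f$ are understood in the Alexandrov sense. Pointwise regularity: for an integer $k\ge0$ and $0<\gamma\le1$, a function $v$ belongs to $C^{k,\gamma}(x_0)$ if there is a polynomial $P_{x_0}$ of degree $k$ such that $v(x)=P_{x_0}(x)+O(|x-x_0|^{k+\gamma})$ for $x$ in the domain of definition of $v$ (here $\overline{B_1^+}$ for $u$ and $\partial B_1^+$ for $\varphi$; near $0$, $\partial B_1^+$ is the flat piece $\{x_n=0\}$, so the condition on $\varphi$ together with $\varphi(0)=0$, $\nabla_{x'}\varphi(0)=0$ says $\varphi(x',0)=O(|x'|^{1+\alpha})$ as $x'\to0$). *)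

(* Defs.v *)
From HB Require Import structures.
From mathcomp Require Import all_boot all_order all_algebra.
From mathcomp Require Import all_classical all_reals all_analysis.
Import Order.TTheory GRing.Theory Num.Theory.
Import numFieldNormedType.Exports.

Set Implicit Arguments.
Unset Strict Implicit.
Unset Printing Implicit Defensive.

Local Open Scope classical_set_scope.
Local Open Scope ring_scope.

Section Euclidean.
Context {R : realType} {n : nat}.
Implicit Types p x : 'rV[R]_n.

Definition dot p x : R := \sum_i p 0 i * x 0 i.

(* The library norm `|x| on 'rV[R]_n is the sup norm. *)
Definition enorm x : R := Num.sqrt (dot x x).

End Euclidean.

(* Lebesgue measure on R^(n+1).  The library only has it on R; here it is the
   Caratheodory measure of the outer measure given by countable box covers, so
   that the measurable sets are exactly the Lebesgue measurable ones. *)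
Section Lebesgue.
Context {R : realType} {n : nat}.
Local Notation E := 'rV[R]_n.+1.

Definition box (ab : E * E) : set E :=
  [set x | forall i, ab.1 0 i < x 0 i <= ab.2 0 i].

Definition box_volume (ab : E * E) : R :=
  \prod_i Num.max 0 (ab.2 0 i - ab.1 0 i).

Definition box_cover (A : set E) : set (nat -> E * E) :=
  [set F | A `<=` \bigcup_k box (F k)].

Local Open Scope ereal_scope.

Definition lebesgue_outer (A : set E) : \bar R :=
  ereal_inf [set \sum_(k <oo) (box_volume (F k))%:E | F in box_cover A].

Lemma box_volume_ge0 ab : 0 <= (box_volume ab)%:E.
Proof. by rewrite lee_fin prodr_ge0// => i _; rewrite le_max lexx. Qed.

Lemma lebesgue_outer_ge0 A : 0 <= lebesgue_outer A.
Proof.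
apply: le_ereal_inf_tmp => _ [F _ <-].
by apply: nneseries_ge0 => k _ _; exact: box_volume_ge0.
Qed.

Lemma le_lebesgue_outer : {homo lebesgue_outer : A B / A `<=` B >-> A <= B}.
Proof.
move=> A B AB; apply/ereal_inf_le_tmp => _ [F BF <-].
by exists F => //; exact: subset_trans BF.
Qed.

Lemma lebesgue_outer0 : lebesgue_outer set0 = 0.
Proof.
apply/eqP; rewrite eq_le lebesgue_outer_ge0 andbT.
apply: ereal_inf_lbound; exists (fun=> (0%R, 0%R)); first by move=> ?.
apply: eseries0 => k _ _ /=; congr EFin.
by rewrite /box_volume big_ord_recl /= subrr maxxx mul0r.
Qed.

Lemma lebesgue_outer_sigma_subadditive : sigma_subadditive lebesgue_outer.
Proof.
move=> A; have [[i ioo]|] := pselect (exists i, lebesgue_outer (A i) = +oo).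
  rewrite (eseries_pinfty _ _ ioo) ?leey// => k _.
  by rewrite -ltNye (lt_le_trans _ (lebesgue_outer_ge0 _)).
rewrite -forallNE => Aoo.
suff add2e (e : {posnum R}) : lebesgue_outer (\bigcup_k A k) <=
    \sum_(i <oo) lebesgue_outer (A i) + e%:num%:E.
  by apply/lee_addgt0Pr => _/posnumP[].
rewrite (le_trans _ (epsilon_trick _ _ _))//; last first.
  by move=> k; exact: lebesgue_outer_ge0.
pose vol ab := (box_volume ab)%:E.
pose P k (F : nat -> E * E) := box_cover (A k) F /\
  \sum_(j <oo) vol (F j) <= lebesgue_outer (A k) + (e%:num / (2 ^ k.+1)%:R)%:E.
have [G PG] : {G : nat -> nat -> E * E & forall k, P k (G k)}.
  apply: (@choice _ _ P) => k; rewrite /P /lebesgue_outer.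
  set S := (X in ereal_inf X); move infS : (ereal_inf S) => iS.
  case: iS infS => [r Sr|Soo|Soo].
  - have en1 : (0 < e%:num / (2 ^ k.+1)%:R)%R by [].
    have /(lb_ereal_inf_adherent en1) : ereal_inf S \is a fin_num by rewrite Sr.
    move=> [x [F AF volFx] xS].
    by exists F; split => //; rewrite /vol volFx -Sr; exact/ltW.
  - by have := Aoo k; rewrite /lebesgue_outer Soo.
  - by have := lebesgue_outer_ge0 (A k); rewrite /lebesgue_outer Soo.
have vol_ge0 x : 0 <= (vol \o uncurry G) x by exact: box_volume_ge0.
apply: (@le_trans _ _ (\esum_(i in setT) (vol \o uncurry G) i)).
  rewrite /lebesgue_outer; apply: ereal_inf_lbound => /=.
  have /card_esym/ppcard_eqP[f] := card_nat2.
  exists (uncurry G \o f).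
    move=> t [i _] /((PG i).1)[j _ Gijt].
    by exists (f^-1%FUN (i, j)) => //=; rewrite invK ?inE.
  rewrite -(esum_pred_image (vol \o uncurry G) _ xpredT) ?[fun=> _]set_true//.
  by rewrite image_eq.
rewrite (_ : esum _ _ = \sum_(i <oo) \sum_(j <oo ) vol (G i j)); last first.
  pose J : nat -> set (nat * nat) := fun i => [set (i, j) | j in setT].
  rewrite (_ : setT = \bigcup_k J k); last first.
    by rewrite predeqE => -[a b]; split => // _; exists a => //; exists b.
  rewrite esum_bigcupT /=; last 2 first.
    - apply/trivIsetP => i j _ _ ij.
      rewrite predeqE => -[k m] /=; split => //= -[] [_] _ [<-{k} _].
      by move=> [m' _] [] /esym/eqP; rewrite (negbTE ij).
    - by move=> /= [k m]; exact: vol_ge0.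
  rewrite -(image_id [set: nat]) -fun_true esum_pred_image//; last first.
    by move=> k _; apply: esum_ge0 => y _; exact: vol_ge0.
  apply: eq_eseriesr => /= j _.
  rewrite -(esum_pred_image (vol \o uncurry G) (pair j) predT)//=; last first.
    by move=> ? ? _ _; exact: (@can_inj _ _ _ snd).
- by move=> ? _; exact: box_volume_ge0.
- by congr esum; rewrite predeqE => -[a b]; split; move=> [i _ <-]; exists i.
apply: lee_lim.
- apply: is_cvg_nneseries => k *.
  by apply: nneseries_ge0 => m *; exact: (vol_ge0 (k, m)).
- apply: is_cvg_nneseries => k *.
  by apply: adde_ge0 => //; exact: lebesgue_outer_ge0.
- by near=> k; apply: lee_sum => i _; exact: (PG i).2.
Unshelve. all: by end_near. Qed.

HB.instance Definition _ := isOuterMeasure.Build R E lebesgue_outer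
  lebesgue_outer0 lebesgue_outer_ge0 le_lebesgue_outer
  lebesgue_outer_sigma_subadditive.

Definition lebesgue_rV : set (caratheodory_type lebesgue_outer) -> \bar R :=
  lebesgue_outer.

Let lebesgue_rV0 : lebesgue_rV set0 = 0.
Proof. exact: lebesgue_outer0. Qed.

Let lebesgue_rV_ge0 A : 0 <= lebesgue_rV A.
Proof. exact: lebesgue_outer_ge0. Qed.

Let lebesgue_rV_sigma_additive : semi_sigma_additive lebesgue_rV.
Proof. exact: caratheodory_measure_sigma_additive. Qed.

HB.instance Definition _ := isMeasure.Build _ _ _ lebesgue_rV
  lebesgue_rV0 lebesgue_rV_ge0 lebesgue_rV_sigma_additive.

End Lebesgue.

Section MongeAmpere.
Context {R : realType} {n : nat}.
Local Notation E := 'rV[R]_n.+1.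
Implicit Types (Omega A : set E) (u f : E -> R).

Definition subdifferential Omega u (x0 : E) : set E :=
  [set p | forall x, Omega x -> u x0 + dot p (x - x0) <= u x].

Definition subdifferential_image Omega u A : set E :=
  \bigcup_(x0 in A) subdifferential Omega u x0.

(* [u], assumed convex, solves det D^2 u = f in Omega in the Alexandrov sense:
   its Monge-Ampere measure has density [f].  The image of a Borel set under
   the subdifferential is Lebesgue measurable, so the outer measure on the
   left is its Lebesgue measure. *)
Definition alexandrov_solution Omega u f : Prop :=
  measurable_fun (Omega : set (caratheodory_type lebesgue_outer)) f /\
  forall A, <<s open >> A -> A `<=` Omega ->
    lebesgue_outer (subdifferential_image Omega u A) =
    (\int[lebesgue_rV]_(x in A) (f x)%:E)%E.

End MongeAmpere.

Section PointwiseRegularity.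
Context {R : realType} {n : nat}.
Local Notation E := 'rV[R]_n.+1.

(* Polynomial functions of degree at most k: [a] runs over the multi-indices
   of length at most k, whose entries are then at most k. *)
Definition polynomial_function (k : nat) (P : E -> R) : Prop :=
  exists c : {ffun 'I_n.+1 -> 'I_k.+1} -> R, forall x,
    P x = \sum_(a : {ffun 'I_n.+1 -> 'I_k.+1} | (\sum_i a i <= k)%N)
            c a * \prod_i x 0 i ^+ a i.

(* v, seen as a function with domain D, belongs to C^{k,gamma}(x0). *)
Definition pointwise_holder (k : nat) (gamma : R) (D : set E) (v : E -> R)
    (x0 : E) : Prop :=
  exists2 P : E -> R, polynomial_function k P &
    (fun x => v x - P x : R^o) =O_ (within D (nbhs x0))
    (fun x => enorm (x - x0) `^ (k%:R + gamma) : R^o).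

End PointwiseRegularity.

Section HalfBall.
Context (R : realType) (m : nat).

Definition last_coord (x : 'rV[R]_m.+1) : R := x 0 ord_max.

Definition half_ball : set 'rV[R]_m.+1 :=
  [set x | enorm x < 1 /\ 0 < last_coord x].

Definition half_ball_boundary : set 'rV[R]_m.+1 :=
  closure half_ball `\` half_ball°.

End HalfBall.

Arguments half_ball : clear implicits.
Arguments half_ball_boundary : clear implicits.

(* The gradient at 0 of x' |-> v (x', 0) exists and vanishes, expressed by the
   partial derivatives in the first m coordinate directions: they only involve
   the values of [v] on the hyperplane {x_n = 0}. *)
Definition tangential_gradient0 (R : realType) (m : nat)
    (v : 'rV[R]_m.+1 -> R) : Prop :=
  forall i : 'I_m,
    is_derive (0 : 'rV[R]_m.+1) (delta_mx 0 (lift ord_max i)) (v : _ -> R^o) 0.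

(* Main.v *)
Require Import Defs.
From mathcomp Require Import all_boot all_order all_algebra.
From mathcomp Require Import all_classical all_reals all_analysis.
From mathcomp Require Import measurable_realfun ring lra zify.
Import Order.TTheory GRing.Theory Num.Theory.
Import numFieldNormedType.Exports.
Local Open Scope classical_set_scope.
Local Open Scope ring_scope.

(* Comparison with a paraboloid gives mu/2 |x'|^2 - N x_n <= u near the flat
   boundary, so u has a finite normal slope a at 0, and u >= a x_n everywhere.
   Put h = s^(m+3) and eta = s^(m+2).  If u - a x_n > h on the whole slice
   x_n = eta, then there u - a x_n dominates both h and mu/2 |x'|^2 - N' eta,
   hence also c s |x'|^2 + (x_n/eta)^2 h/4 + (s/4) x_n, whose Hessian determinant
   is of order s^m s^-(m+1) = 1/s, beyond Lambda for small s; by comparison the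
   slope of u at 0 would be at least a + s/4.  So the slice contains a point with
   u - a x_n <= h.  That point may lie far from the axis; joining it to the
   opposite flat boundary point, where u = O(|x'|^(1+alpha)), gives the decay
   u - a x_n <= C x_n^(1+alpha') on the axis, and midpoints of the axis and the
   flat boundary give it everywhere. *)

(** * Outer measure of boxes and of diagonal affine images *)

Section LebesgueOuter.
Context {R : realType}.

Lemma lebesgue_measure_itvoc (a b : R) :
  lebesgue_measure `]a, b]%classic = (Num.max 0 (b - a))%:E.
Proof.
rewrite lebesgue_measure_itv /= lte_fin; case: ltP => ab.
  by rewrite -EFinB max_r// subr_ge0 ltW.
by rewrite max_l// subr_le0.
Qed.

(* Fubini for box covers: integrate out one coordinate at a time; the weights
   [c] carry the indicators of the coordinates that are still frozen. *)
Lemma box_volume_le_cover (n : nat) (p q : 'I_n -> R) (a b : nat -> 'I_n -> R)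
    (c : nat -> R) : (forall k, 0 <= c k) ->
  (forall x : 'I_n -> R, (forall i, p i < x i <= q i) ->
    (1 <= \sum_(k <oo) (c k * \prod_i \1_(`]a k i, b k i]%classic) (x i))%:E)%E) ->
  ((\prod_i Num.max 0 (q i - p i))%:E <=
    \sum_(k <oo) (c k * \prod_i Num.max 0 (b k i - a k i))%:E)%E.
Proof.
elim: n p q a b c => [|n IH] p q a b c c0 cov.
  have := cov (fun=> 0); rewrite !big_ord0 => /(_ _)/le_trans -> //; first by case.
  by apply: lee_nneseries => [k _|k _]; rewrite lee_fin ?big_ord0 ?mulr1.
pose V' k := \prod_(i < n) Num.max 0 (b k (lift ord0 i) - a k (lift ord0 i)).
pose P' := \prod_(i < n) Num.max 0 (q (lift ord0 i) - p (lift ord0 i)).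
have V'0 k : 0 <= V' k by apply: prodr_ge0 => i _; rewrite le_max lexx.
have slice t : `]p ord0, q ord0]%classic t ->
    (P'%:E <= \sum_(k <oo) (c k * V' k * \1_(`]a k ord0, b k ord0]%classic) t)%:E)%E.
  rewrite /= in_itv /= => tpq.
  have := IH (fun i => p (lift ord0 i)) (fun i => q (lift ord0 i))
    (fun k i => a k (lift ord0 i)) (fun k i => b k (lift ord0 i))
    (fun k => c k * \1_(`]a k ord0, b k ord0]%classic) t).
  rewrite -/P' => h; apply: le_trans (h _ _) _.
  - by move=> k; rewrite mulr_ge0.
  - move=> x xpq.
    have /= := cov (fun i => if unlift ord0 i is Some j then x j else t).
    move=> /(_ _)/le_trans -> //.
      by move=> i; case: unliftP => [j ->|->].
    apply: lee_nneseries => [k _|k _].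
      by rewrite lee_fin mulr_ge0// prodr_ge0.
    rewrite lee_fin big_ord_recl unlift_none mulrA.
    suff -> : \prod_(i < n) \1_(`]a k (lift ord0 i), b k (lift ord0 i)]%classic)
        (if unlift ord0 (lift ord0 i) is Some j then x j else t) =
        \prod_i \1_(`]a k (lift ord0 i), b k (lift ord0 i)]%classic) (x i) :> R by [].
    by apply: eq_bigr => i _; rewrite liftK.
  - apply: lee_nneseries => [k _|k _]; rewrite lee_fin.
      by move=> _; apply: mulr_ge0; [exact: mulr_ge0 | exact: V'0].
    by rewrite mulrAC.
(* Integrate [slice] over [t] in [D] and exchange sum and integral: the [k]-th indicator contributes
   the length of its interval inside [D], at most the full length. *)
rewrite big_ord_recl -/P' EFinM -lebesgue_measure_itvoc muleC.
set D := `]p ord0, q ord0]%classic.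
have mI x y : measurable (`]x, y]%classic : set R) by exact: measurable_itv.
have mD : measurable D by exact: mI.
have V'1 k x : 0 <= c k * V' k * \1_(`]a k ord0, b k ord0]%classic) x.
  by rewrite mulr_ge0// mulr_ge0.
have mf k : measurable_fun D (EFin \o (fun x : R =>
    c k * V' k * \1_(`]a k ord0, b k ord0]%classic) x)).
  by apply/measurable_EFinP; apply: measurable_funM.
rewrite -integral_cst//.
apply: (@le_trans _ _ (\int[lebesgue_measure]_(x in D)
   \sum_(k <oo) (c k * V' k * \1_(`]a k ord0, b k ord0]%classic) x)%:E)%E).
  apply: ge0_le_integral => //.
  - by move=> x _; rewrite lee_fin prodr_ge0// => i _; rewrite le_max lexx.
  - apply: (ge0_emeasurable_sum (P := xpredT)) (fun k _ => mf k) => k x _ _.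
    by rewrite lee_fin.
rewrite integral_nneseries// => [|k x _]; last by rewrite lee_fin.
apply: lee_nneseries => [k _|k _].
  by move=> _; apply: integral_ge0 => x _; rewrite lee_fin.
under eq_integral do rewrite EFinM.
rewrite ge0_integralZl//; last 2 first.
- by apply/measurable_EFinP; exact: measurable_indic.
- by rewrite lee_fin mulr_ge0.
rewrite integral_indic// big_ord_recl -/(V' k) mulrCA EFinM muleC -EFinM [leRHS]EFinM.
rewrite lee_wpmul2r// ?lee_fin ?mulr_ge0// -lebesgue_measure_itvoc.
by apply: le_measure; [apply/mem_set; exact: measurableI | apply/mem_set; exact: mI|
  exact: subIsetl].
Qed.

(** For a box cover, the sum of the products of indicators is at least 1 at every point of the box,
    so the covering inequality applies with all weights 1. *)
Lemma le_lebesgue_outer_box (n : nat) (ab : 'rV[R]_n.+1 * 'rV[R]_n.+1) :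
  ((box_volume ab)%:E <= lebesgue_outer (box ab))%E.
Proof.
apply: le_ereal_inf_tmp => _ [F covF <-].
have := @box_volume_le_cover n.+1 (fun i => ab.1 0 i) (fun i => ab.2 0 i)
  (fun k i => (F k).1 0 i) (fun k i => (F k).2 0 i) (fun=> 1) (fun=> ler01).
under [X in (_ -> _ <= X)%E]eq_eseriesr do rewrite mul1r.
apply=> x xab.
have [|k _ /= xFk] := covF (\row_i x i) _; first by move=> i; rewrite mxE.
have term0 j :
    (0 <= (1 * \prod_i \1_(`](F j).1 0 i, (F j).2 0 i]%classic) (x i) : R)%:E)%E.
  by rewrite lee_fin mul1r prodr_ge0.

apply: le_trans (nneseries_lim_ge k.+1 (fun j _ _ => term0 j)).
rewrite big_nat_recr//= -[leLHS]add0e leeD ?sume_ge0//.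
rewrite mul1r lee_fin big1// => i _.
by rewrite indicE mem_set//= in_itv/=; have := xFk i; rewrite mxE.
Qed.

Lemma lebesgue_outer_box_le (n : nat) (ab : 'rV[R]_n.+1 * 'rV[R]_n.+1) :
  (lebesgue_outer (box ab) <= (box_volume ab)%:E)%E.
Proof.
(* The cover is the box itself, padded by [(0, 0)], a half-open box that is empty and has volume 0
   since there is at least one coordinate. *)
pose F k : 'rV[R]_n.+1 * 'rV[R]_n.+1 := if k == 0%N then ab else (0, 0).
apply: ereal_inf_lbound; exists F; first by move=> x abx; exists 0%N.
rewrite nneseries_recl//= => [|k _]; last exact: box_volume_ge0.
rewrite eseries0 ?adde0// => -[//|k] _ _.
by rewrite /F /= /box_volume big_ord_recl /= subrr maxxx mul0r.
Qed.

(** Gradients of diagonal paraboloids are maps of this form. A box cover of the image pulls back to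
    a box cover of [G] whose volumes are smaller by the factor [\prod_i c i]. *)
Lemma lebesgue_outer_diag (n : nat) (G : set 'rV[R]_n.+1) (c b : 'I_n.+1 -> R) :
  (forall i, 0 < c i) ->
  ((\prod_i c i)%:E * lebesgue_outer G <=
   lebesgue_outer [set (\row_i (c i * x 0 i + b i))%R | x in G])%E.
Proof.
move=> c0; have P0 : 0 < \prod_i c i by exact: prodr_gt0.
apply: le_ereal_inf_tmp => _ [F covF <-].
pose pull (y : 'rV[R]_n.+1) : 'rV[R]_n.+1 := \row_i ((y 0 i - b i) / c i).
pose F' k := (pull (F k).1, pull (F k).2).
have covF' : box_cover G F'.
  move=> x Gx; have [|k _ xF] := covF (\row_i (c i * x 0 i + b i)); first by exists x.
  exists k => // i; have := xF i; rewrite !mxE => /andP[l r] /=.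
  by rewrite ltr_pdivrMr// ler_pdivlMr// ltrBlDr lerBrDr mulrC l.
have volF' k : box_volume (F k) = (\prod_i c i) * box_volume (F' k).
  rewrite /box_volume -big_split /=; apply: eq_bigr => i _.
  rewrite !mxE maxr_pMr ?(ltW (c0 i))// mulr0; congr Num.max.
  by field; rewrite gt_eqF.
under eq_eseriesr do rewrite volF' EFinM.
rewrite nneseriesZl => [|k _]; last exact: box_volume_ge0.
rewrite lee_wpmul2l ?lee_fin ?(ltW P0)//.
by apply: ereal_inf_lbound; exists F'.
Qed.

End LebesgueOuter.

(** * Integrals of bounded densities *)

Section IntegralBound.
Import HBSimple HBNNSimple.

(* [A] need not be measurable: a simple function below [f \_ A] is supported on
   a measurable subset of [A]. *)
Lemma integral_le_lebesgue_outer (R : realType) (n : nat)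
    (A : set 'rV[R]_n.+1) (f : 'rV[R]_n.+1 -> R) (L : R) :
  0 <= L -> (forall x, A x -> 0 <= f x <= L) ->
  (\int[lebesgue_rV]_(x in A) (f x)%:E <= L%:E * lebesgue_outer A)%E.
Proof.
move=> L0 fL; rewrite ge0_integralE => [|x Ax]; last first.
  by rewrite lee_fin; case/andP: (fL x Ax).
apply: ge_ereal_sup => _ [h hf <-].
pose T := h @^-1` [set~ 0].
have mT : measurable T.
  by rewrite /T -preimage_setC; apply: measurableC; exact: measurable_sfunP.
have TA : T `<=` A.
  move=> x /= hx; apply: contrapT => Ax; apply: hx; apply/eqP.
  rewrite eq_le fun_ge0 andbT -lee_fin (le_trans (hf x))// patchE.
  by case: ifPn => [/set_mem /Ax|_].
(* The support [T] of [h] is measurable and lies in [A], and [h] is at most [L] times its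
   indicator. *)
apply: (@le_trans _ _ (L%:E * lebesgue_rV T)%E); last first.
  by apply: lee_wpmul2l; [rewrite lee_fin | exact: le_lebesgue_outer].
rewrite -(integralT_nnsfun lebesgue_rV h) -[T]setIT -integral_indic//.
rewrite -ge0_integralZl//; last first.
  by apply/measurable_EFinP; exact: measurable_indic.
apply: ge0_le_integral => //.
- by move=> x _; rewrite lee_fin.
- by apply/measurable_EFinP; exact: measurable_funP.
- by apply/measurable_EFinP; apply: measurable_funM => //; exact: measurable_indic.
move=> x _; rewrite -EFinM lee_fin indicE.
have [/set_mem Tx|/negP Tx] := boolP (x \in T).
  have := hf x; rewrite patchE mem_set; last exact: TA.
  by rewrite lee_fin mulr1 => /le_trans; apply; case/andP: (fL x (TA x Tx)).
rewrite mulr0; suff -> : h x = 0 by [].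
by apply: contrapT => hx; apply: Tx; apply/mem_set.
Qed.

End IntegralBound.

(** * Convexity inequality and cubic neighbourhoods *)

Lemma convex_functionP {R : realType} {n : nat} {D : set 'rV[R]_n}
    {u : 'rV[R]_n -> R} (x y : 'rV[R]_n) (t : R) :
  convex_function D u -> D x -> D y -> 0 <= t <= 1 ->
  u (t *: x + (1 - t) *: y) <= t * u x + (1 - t) * u y.
Proof.
move=> cu Dx Dy /andP[t0 t1].
exact: (cu (Itv01 t0 t1) x y (mem_set Dx) (mem_set Dy)).
Qed.

Lemma open_cube {R : realType} {n : nat} {A : set 'rV[R]_n} {x : 'rV[R]_n} :
  open A -> A x ->
  exists2 e : R, 0 < e & forall y : 'rV[R]_n, (forall i, `|y 0 i - x 0 i| < e) -> A y.
Proof.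
move=> oA Ax; have : nbhs x A by exact: open_nbhs_nbhs.
move=> /nbhs_ballP[e /= e0 eA]; exists e => // y xy; apply: eA; split => // i j.
by rewrite ord1 /ball /= distrC.
Qed.

(** * Comparison of Alexandrov solutions with diagonal paraboloids *)

Section Comparison.
Context {R : realType} {n : nat}.
Local Notation E := 'rV[R]_n.+1.
Implicit Types (Omega S : set E) (u f : E -> R) (c b : 'I_n.+1 -> R).

(** The Hessian is diagonal with entries [2 * c i], so its determinant is [\prod_i (2 * c i)]; there
    is no constant term, as the barriers vanish at the origin. *)
Definition diag_quad c b (x : E) : R := \sum_i (c i * x 0 i ^+ 2 + b i * x 0 i).

Definition diag_quad_grad c b (x : E) : E := \row_i (2 * c i * x 0 i + b i).

(** The gap between the two sides is the sum of [c i * (y 0 i - x 0 i) ^+ 2]. *)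
Lemma diag_quad_tangent c b (x y : E) : (forall i, 0 <= c i) ->
  diag_quad c b x + dot (diag_quad_grad c b x) (y - x) <= diag_quad c b y.
Proof.
move=> c0; rewrite -big_split /=; apply: ler_sum => i _; rewrite !mxE.
by have := mulr_ge0 (c0 i) (sqr_ge0 (y 0 i - x 0 i)); lra.
Qed.

Lemma diag_quad_continuous c b : continuous (diag_quad c b).
Proof.
move=> x; apply: (@cvg_big _ _ +%R 0 _ add_continuous _ (nbhs x)) => i _.
  have xi := @coord_continuous R _ _ 0 i x.
by apply: cvgD; apply: cvgM; do ?exact: cvg_cst; do ?apply: cvgM.
Qed.

Lemma dot_continuous (p : E) : continuous (dot p).
Proof.
move=> x; apply: (@cvg_big _ _ +%R 0 _ add_continuous _ (nbhs x)) => i _.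
  apply: cvgM; first exact: cvg_cst.
exact: coord_continuous.
Qed.

Lemma dotDr (p x y : E) : dot p (x + y) = dot p x + dot p y.
Proof. by rewrite -big_split; apply: eq_bigr => i _; rewrite mxE mulrDr. Qed.

Lemma dotZr (p x : E) (t : R) : dot p (t *: x) = t * dot p x.
Proof. by rewrite mulr_sumr; apply: eq_bigr => i _; rewrite mxE mulrCA. Qed.

Lemma dotNr (p x : E) : dot p (- x) = - dot p x.
Proof. by rewrite -scaleN1r dotZr mulN1r. Qed.

(* Slide the tangent plane of the paraboloid at [x1] down until it supports
   the graph of [u]. *)
Lemma slide_tangent_plane Omega S u c b (x1 : E) :
  compact (closure Omega) -> open S -> S `<=` Omega ->
  {within closure Omega, continuous u} -> convex_function (closure Omega) u ->
  (forall i, 0 < c i) ->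
  (forall x, closure S x -> ~ S x -> diag_quad c b x <= u x) ->
  S x1 -> u x1 < diag_quad c b x1 ->
  exists2 x2, S x2 /\ u x2 < diag_quad c b x2 &
    subdifferential Omega u x2 (diag_quad_grad c b x1).
Proof.
move=> cptO oS SO cont cvx c0 bd Sx1 ux1.
set w := diag_quad c b; set p := diag_quad_grad c b x1.
have cO x : Omega x -> closure Omega x by exact: subset_closure.
pose l x := w x1 - dot p x1 + dot p x.
have lw x : l x <= w x.
  have := diag_quad_tangent c b x1 x (fun i => ltW (c0 i)).
  by rewrite -/p -/w dotDr dotNr /l; lra.
have cl : continuous l.
  move=> x; apply: (cvgD (F := nbhs x) (f := fun=> w x1 - dot p x1)).
    exact: cvg_cst.
  exact: dot_continuous.
have ScO : closure S `<=` closure Omega by exact: closure_subset.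
have cptS : compact (closure S).
  by apply: subclosed_compact cptO ScO; exact: closed_closure.
have [||x2 /set_mem Sx2 minx2] := @EVT_min_rV _ _ (fun x => u x - l x) _ _ cptS.
- by exists x1; exact: subset_closure.
- move=> x; apply: continuousB; first exact: (continuous_subspaceW ScO cont).
  exact: (continuous_subspaceT cl).
(* The minimum of [u - l] over [closure S] is negative, whereas [l <= w <= u] on the rest of the
   closure; so it is attained in [S]. *)
have gx1 : u x1 - l x1 < 0 by rewrite /l /w; lra.
have gx2 : u x2 - l x2 < 0.
  by apply: le_lt_trans gx1; apply: minx2; exact/mem_set/subset_closure.
have SSx2 : S x2.
  apply: contrapT => nS; have := bd _ Sx2 nS; have := lw x2; rewrite -/w => h1 h2.
  by move: gx2; apply/negP; rewrite -leNgt subr_ge0 (le_trans h1).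
exists x2.
  by split => //; apply: lt_le_trans (lw x2); rewrite -subr_lt0.
move=> x Ox.
(* Minimality is known only on [closure S]. A short initial piece of the segment from [x2] to [x]
   stays in [S], and convexity carries the inequality from there to [x]. *)
have [e e0 eS] := open_cube oS SSx2.
have [t /andP[t0 t1] te] : exists2 t : R, 0 < t <= 1 &
    forall i, t * `|x 0 i - x2 0 i| < e.
  pose s := \sum_i `|x 0 i - x2 0 i|.
  have s0 : 0 <= s by exact: sumr_ge0.
  have es0 : 0 < e + s by lra.
  exists (e / (e + s)); first by rewrite divr_gt0// ler_pdivrMr// mul1r lerDl.
  move=> i; rewrite mulrAC ltr_pdivrMr// ltr_pM2l//.
  by rewrite /s (bigD1 i)//= addrCA ltrDl ltr_wpDr// sumr_ge0.
have zS : S (t *: x + (1 - t) *: x2).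
  apply: eS => i; rewrite !mxE (_ : _ - _ = t * (x 0 i - x2 0 i)); last by ring.
  by rewrite normrM ger0_norm// ltW.
have := minx2 _ (mem_set (subset_closure zS)).
have := convex_functionP x x2 t cvx (cO _ Ox) (cO _ (SO _ SSx2)).
rewrite (ltW t0) t1 => /(_ isT).
rewrite /l !dotDr !dotZr dotNr => h1 h2.
by rewrite -(ler_pM2l t0); lra.
Qed.

(** Suppose [u < w] somewhere in [S], and let [G] be the open set where this happens. Sliding
    tangent planes shows that the gradient of [w] maps [G] into the subdifferential image of [G]
    under [u]. The former has measure at least [\prod_i (2 * c i)] times that of [G], the latter at
    most [L] times it; this is absurd, as the measure of [G] is positive and finite. *)
Lemma alexandrov_comparison Omega S u f c b (L : R) :
  compact (closure Omega) -> open S -> S `<=` Omega ->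
  {within closure Omega, continuous u} -> convex_function (closure Omega) u ->
  alexandrov_solution Omega u f -> (forall x, Omega x -> 0 <= f x <= L) ->
  (forall i, 0 < c i) -> L < \prod_i (2 * c i) ->
  (forall x, closure S x -> ~ S x -> diag_quad c b x <= u x) ->
  forall x, S x -> diag_quad c b x <= u x.
Proof.
move=> cptO oS SO cont cvx [_ MAu] fL c0 Lc bd x0 Sx0.
rewrite leNgt; apply/negP => ux0.
set w := diag_quad c b in bd ux0 *.
pose G := S `&` [set x | u x < w x].
have Gx0 : G x0 by [].
have GO : G `<=` Omega by move=> x [/SO].
have oG : open G.
  rewrite openE => x [Sx uwx]; rewrite /interior.
  have cu : {for x, continuous u}.
    have : {within S, continuous u}.
      by apply: continuous_subspaceW cont => y /SO; exact: subset_closure.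
    by rewrite continuous_open_subspace//; apply; exact/mem_set.
  have cwu : (fun y => w y - u y) y @[y --> x] --> w x - u x.
    by apply: (cvgB (F := nbhs x)) => //; exact: diag_quad_continuous.
  apply: filterI; first exact: open_nbhs_nbhs.
  have : \forall y \near x, 0 < w y - u y.
    by apply: (cvgr_gt (w x - u x) cwu); rewrite subr_gt0.
  by apply: filterS => y; rewrite subr_gt0.
have sub : [set (\row_i (2 * c i * x 0 i + b i)) | x in G] `<=`
    subdifferential_image Omega u G.
  move=> _ [x1 [Sx1 ux1] <-].
  have [x2 [Sx2 ux2] px2] :=
    slide_tangent_plane _ _ _ _ _ _ cptO oS SO cont cvx c0 bd Sx1 ux1.
  by exists x2.
have c2 i : 0 < 2 * c i by rewrite mulr_gt0.
have L0 : 0 <= L by case/andP: (fL _ (GO _ Gx0)) => /le_trans; exact.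
have := lebesgue_outer_diag n G _ b c2.
move=> /le_trans /(_ (le_lebesgue_outer sub)).
rewrite MAu//; last exact: sub_sigma_algebra.
have fG x : G x -> 0 <= f x <= L by move=> /GO; exact: fL.
move=> /le_trans /(_ (integral_le_lebesgue_outer _ _ _ _ _ L0 fG)).
apply/negP; rewrite -ltNge.
have [e e0 eG] := open_cube oG Gx0.
pose lo : E := \row_i (x0 0 i - e / 2); pose hi : E := \row_i (x0 0 i + e / 2).
have Gpos : (0 < lebesgue_outer G)%E.
  have boxG : box (lo, hi) `<=` G.
    move=> x xb; apply: eG => i; have := xb i; rewrite !mxE /= ltr_norml; lra.
  apply: lt_le_trans (le_lebesgue_outer boxG).
  apply: lt_le_trans (le_lebesgue_outer_box _ _).
  rewrite lte_fin prodr_gt0// => i _; rewrite !mxE lt_max; apply/orP; right; lra.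
have Gfin : lebesgue_outer G \is a fin_num.
  rewrite ge0_fin_numE ?lebesgue_outer_ge0//.
  have [M [_ /(_ (M + 1)) bO]] := compact_bounded cptO.
  (* Coordinates are bounded by [M + 1]; the extra unit gives the strict inequality at the open
     lower end of the box. *)
  have GM : G `<=` box (const_mx (- (M + 2)), const_mx (M + 2)).
    move=> x Gx i; rewrite !mxE.
    have xM : `|x| <= M + 1.
      by apply: bO; [rewrite ltrDl | exact/subset_closure/GO].
    have : `|x 0 i| <= `|x|.
      by rewrite [leRHS]mx_normrE; exact: (le_bigmax _ _ (0, i)).
    by move=> /le_trans /(_ xM); rewrite ler_norml; lra.
  apply: le_lt_trans (le_lebesgue_outer GM) _.
  by apply: le_lt_trans (lebesgue_outer_box_le _ _) _; rewrite ltry.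
by rewrite lte_pmul2r.
Qed.
End Comparison.

(** * Geometry of the half ball and its closure *)

Section Geometry.
Context {R : realType} {m : nat}.
Local Notation E := 'rV[R]_m.+1.
Implicit Types (x y : E) (t : R).

Lemma dot_ge0 x : 0 <= dot x x.
Proof. by apply: sumr_ge0 => i _; rewrite -expr2 sqr_ge0. Qed.

Lemma enormE2 x : enorm x ^+ 2 = dot x x.
Proof. by rewrite sqr_sqrtr// dot_ge0. Qed.

Lemma enorm_le x t : 0 <= t -> (enorm x <= t) = (dot x x <= t ^+ 2).
Proof. by move=> t0; rewrite -enormE2 ler_pXn2r// nnegrE sqrtr_ge0. Qed.

Lemma enorm_lt x t : 0 <= t -> (enorm x < t) = (dot x x < t ^+ 2).
Proof. by move=> t0; rewrite -enormE2 ltr_pXn2r// nnegrE sqrtr_ge0. Qed.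

Lemma dot_diag_quad x : dot x x = diag_quad (fun=> 1) (fun=> 0) x.
Proof. by apply: eq_bigr => i _; rewrite mul1r mul0r addr0 expr2. Qed.

Lemma dot_self_continuous : continuous (fun x => dot x x).
Proof.
rewrite (_ : (fun x => _) = diag_quad (fun=> 1) (fun=> 0)).
  exact: diag_quad_continuous.
by apply/funext => x; exact: dot_diag_quad.
Qed.

Lemma last_coord_continuous : continuous (@last_coord R m).
Proof. by move=> x; exact: coord_continuous. Qed.

Lemma coord_le_dot x i : x 0 i ^+ 2 <= dot x x.
Proof.
rewrite /dot (bigD1 i)//= -expr2 lerDl sumr_ge0// => j _.
by rewrite -expr2 sqr_ge0.
Qed.

Definition axis t : E := t *: delta_mx 0 ord_max.

Definition tangential x : E := x - axis (last_coord x).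

Lemma axisE t i : axis t 0 i = if i == ord_max then t else 0.
Proof. by rewrite !mxE /=; case: eqP => _; rewrite ?mulr1 ?mulr0. Qed.

Lemma add_axisE x t i :
  (x + axis t) 0 i = x 0 i + (if i == ord_max then t else 0).
Proof. by rewrite mxE axisE. Qed.

Lemma last_coord_axis t : last_coord (axis t) = t.
Proof. by rewrite /last_coord axisE eqxx. Qed.

Lemma last_coord_tangential x : last_coord (tangential x) = 0.
Proof. by rewrite /last_coord mxE mxE axisE eqxx subrr. Qed.

Lemma dot_lastE x :
  dot x x = \sum_(i | i != ord_max) x 0 i ^+ 2 + last_coord x ^+ 2.
Proof.
by rewrite /dot (bigD1 ord_max)//= addrC -expr2; under eq_bigr do rewrite -expr2.
Qed.

Lemma dot_axis t : dot (axis t) (axis t) = t ^+ 2.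
Proof.
rewrite dot_lastE last_coord_axis big1 ?add0r// => i /negPf im.
by rewrite axisE im expr0n.
Qed.

Lemma dot_tangential x :
  dot (tangential x) (tangential x) = dot x x - last_coord x ^+ 2.
Proof.
rewrite !dot_lastE last_coord_tangential expr0n addr0 addrK.
by apply: eq_bigr => i /negPf im; rewrite !mxE /= im mulr0 subr0.
Qed.

Lemma dotZZ t x : dot (t *: x) (t *: x) = t ^+ 2 * dot x x.
Proof.
by rewrite mulr_sumr; apply: eq_bigr => i _; rewrite !mxE; ring.
Qed.

Lemma half_ballE x : half_ball R m x <-> dot x x < 1 /\ 0 < last_coord x.
Proof. by rewrite /half_ball /= enorm_lt// expr1n. Qed.

Lemma open_half_ball : open (half_ball R m).
Proof.
have -> : half_ball R m = [set x | dot x x < 1] `&` [set x | 0 < last_coord x].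
  by apply/seteqP; split => x /half_ballE.
apply: openI.
  have := @open_comp _ _ (fun x : E => dot x x) [set r | r < 1].
  by apply => // x _; exact: dot_self_continuous.
have := @open_comp _ _ (@last_coord R m) [set r | 0 < r].
by apply => // x _; exact: last_coord_continuous.
Qed.

Lemma closure_half_ball x : closure (half_ball R m) x ->
  dot x x <= 1 /\ 0 <= last_coord x.
Proof.
pose C := [set x : E | dot x x <= 1] `&` [set x | 0 <= last_coord x].
have clC : closed C.
  apply: closedI.
    have := @closed_comp _ _ (fun x : E => dot x x) [set r | r <= 1].
    by apply => // y _; exact: dot_self_continuous.
  have := @closed_comp _ _ (@last_coord R m) [set r | 0 <= r].
  by apply => // y _; exact: last_coord_continuous.
have sub : half_ball R m `<=` C.
  by move=> y /half_ballE[y1 y0]; split; exact: ltW.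
by move=> /(closure_subset sub) clx; have : C x by rewrite (closure_id C).1.
Qed.

Lemma flat_closure x : dot x x < 1 -> 0 <= last_coord x ->
  closure (half_ball R m) x.
Proof.
move=> x1 x0 B /nbhs_ballP[e /= e0 eB].
have lx : last_coord x <= 1.
  by have := coord_le_dot x ord_max; rewrite -/(last_coord x); nra.
(* Lifting [x] by [t] makes the last coordinate positive and raises [dot x x] by at most [3 * t], as
   [last_coord x] and [t] are at most 1; this is less than [1 - dot x x]. *)
pose t := Num.min (e / 2) (Num.min 1 ((1 - dot x x) / 4)).
have [t0 te t1 t2] : [/\ 0 < t, t < e, t <= 1 & t < (1 - dot x x) / 3].
  split.
  - by rewrite !lt_min; lra.
  - by rewrite gt_min; apply/orP; left; lra.
  - by rewrite !ge_min lexx orbT.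
  - by rewrite !gt_min; apply/orP; right; apply/orP; right; lra.
have tE : dot (x + axis t) (x + axis t) = dot x x + 2 * t * last_coord x + t ^+ 2.
  rewrite !dot_lastE /last_coord add_axisE eqxx.
  under eq_bigr => i /negPf im do rewrite add_axisE im addr0.
  by ring.
exists (x + axis t); split.
  apply/half_ballE; split; last by rewrite /last_coord add_axisE eqxx ltr_wpDl.
  by rewrite tE; nra.
apply: eB; split => // i j; rewrite ord1 /ball /= add_axisE.
rewrite opprD addrA subrr add0r normrN.
by case: ifP => _; rewrite ?normr0// gtr0_norm.
Qed.

Lemma compact_closure_half_ball : compact (closure (half_ball R m)).
Proof.
apply: bounded_closed_compact; last exact: closed_closure.
exists 1; split=> // M M1 x /closure_half_ball[x1 _].
rewrite /= [leLHS]mx_normrE; apply/bigmax_leP; split=> [|[i j] _]; first lra.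
by rewrite ord1 ler_norml; have := coord_le_dot x j; nra.
Qed.

Lemma half_ball_boundaryP x : closure (half_ball R m) x -> ~ half_ball R m x ->
  half_ball_boundary R m x.
Proof. by move=> cx nx; split=> // /interior_subset. Qed.

End Geometry.

(** * Polynomials of degree at most one are affine *)

Section Affine.
Context {R : realType} {n : nat}.
Local Notation E := 'rV[R]_n.+1.

Lemma dot_delta i (x : E) : dot (delta_mx 0 i) x = x 0 i.
Proof.
rewrite /dot (bigD1 i)//= mxE !eqxx mul1r big1 ?addr0// => j /negPf ji.
by rewrite mxE ji andbF mul0r.
Qed.

Lemma dot_suml (I : Type) (r : seq I) (P : pred I) (p : I -> E) (x : E) :
  dot (\sum_(j <- r | P j) p j) x = \sum_(j <- r | P j) dot (p j) x.
Proof.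
rewrite /dot exchange_big /=; apply: eq_bigr => i _.
by rewrite summxE mulr_suml.
Qed.

Lemma dotZl (c : R) (p x : E) : dot (c *: p) x = c * dot p x.
Proof. by rewrite mulr_sumr; apply: eq_bigr => i _; rewrite mxE mulrA. Qed.

Lemma dot0l (x : E) : dot 0 x = 0.
Proof. by rewrite -(scale0r 0) dotZl mul0r. Qed.

(** A multi-index of length at most one is zero or has a single entry 1, so the monomial is constant
    or a coordinate. *)
Lemma monomial_affine (a : {ffun 'I_n.+1 -> 'I_2}) : (\sum_i a i <= 1)%N ->
  exists q : E, forall x : E,
    \prod_i x 0 i ^+ a i = \prod_i (0 : E) 0 i ^+ a i + dot q x.
Proof.
move=> a1; have [/existsP[i ai]|/existsPn a0] := boolP [exists i, a i != 0 :> nat].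
  have aj j : j != i -> a j = 0 :> nat.
    by move=> ji; move: a1; rewrite (bigD1 i)//= (bigD1 j)//=; lia.
  have ai1 : a i = 1 :> nat by move: a1; rewrite (bigD1 i)//=; lia.
  have prodE (x : E) : \prod_j x 0 j ^+ a j = x 0 i.
    by rewrite (bigD1 i)//= ai1 big1 ?mulr1// => j /aj ->.
  by exists (delta_mx 0 i) => x; rewrite !prodE mxE add0r dot_delta.
exists 0 => x; rewrite dot0l addr0; apply: eq_bigr => i _.
by have /negPn/eqP -> := a0 i.
Qed.

Lemma polynomial_function1_affine (P : E -> R) : polynomial_function 1 P ->
  exists p : E, forall x, P x = P 0 + dot p x.
Proof.
move=> [c Pc].
have /choice[q qP] : forall a : {ffun 'I_n.+1 -> 'I_2}, exists q : E,
    (\sum_i a i <= 1)%N -> forall x : E,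
    \prod_i x 0 i ^+ a i = \prod_i (0 : E) 0 i ^+ a i + dot q x.
  move=> a; have [/monomial_affine[q qx]|] := boolP (\sum_i a i <= 1)%N.
    by exists q.
  by exists 0.
exists (\sum_(a : {ffun 'I_n.+1 -> 'I_2} | (\sum_i a i <= 1)%N) c a *: q a) => x.
rewrite !Pc dot_suml -big_split/=; apply: eq_bigr => a a1.
by rewrite dotZl -mulrDr -qP.
Qed.

Lemma coord_polynomial (a : R) (i : 'I_n.+1) :
  polynomial_function 1 (fun x : E => a * x 0 i).
Proof.
pose d : {ffun 'I_n.+1 -> 'I_2} := [ffun j => if j == i then ord_max else ord0].
have dE j : d j = (j == i) :> nat by rewrite ffunE; case: eqP.
exists (fun b => if b == d then a else 0) => x.
rewrite (bigD1 d)/=; last first.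
  by rewrite (bigD1 i)//= dE eqxx big1// => j /negPf ji; rewrite dE ji.
rewrite eqxx [X in _ = _ + X]big1 ?addr0; last first.
  by move=> b /andP[_ /negPf ->]; rewrite mul0r.
rewrite (bigD1 i)//= dE eqxx big1 ?mulr1// => j /negPf ji.
by rewrite dE ji.
Qed.
End Affine.

(** * Growth of the boundary data on the flat part *)

Lemma powR_le_expr6 {R : realType} (alpha r s : R) : 1 / 5 < alpha ->
  0 <= r <= s ^+ 5 -> 0 <= s <= 1 -> r `^ (1 + alpha) <= s ^+ 6.
Proof.
move=> a5 /andP[r0 rs] /andP[s0 s1].
have [->|rn0] := eqVneq r 0; first by rewrite powR0 ?exprn_ge0//; lra.
have rgt0 : 0 < r by rewrite lt_neqAle eq_sym rn0.
have s51 : s ^+ 5 <= 1 by rewrite exprn_ile1.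
have r1 : r <= 1 by lra.
(* As [r <= 1] and [1 + alpha > 6 / 5], the exponent may be lowered to [6 / 5], which turns [s ^+ 5]
   into [s ^+ 6]. *)
apply: (@le_trans _ _ (r `^ (6 / 5))); first by apply: ger_powR; lra.
have -> : s ^+ 6 = (s ^+ 5) `^ (6 / 5).
  rewrite -[s ^+ 5]powR_mulrn// -powRrM -[LHS]powR_mulrn//; congr (_ `^ _); lra.
by apply: ge0_ler_powR; rewrite ?nnegrE ?exprn_ge0//; lra.
Qed.

(* The exponent 1/5 lets distances be measured in fifth powers, so that no
   real exponent is left. *)
Lemma flat_boundary_bound {R : realType} {m : nat} (alpha : R)
    (phi : 'rV[R]_m.+1 -> R) :
  1 / 5 < alpha -> pointwise_holder 1 alpha (half_ball_boundary R m) phi 0 ->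
  phi 0 = 0 -> tangential_gradient0 phi ->
  exists C s0 : R, [/\ 0 < C, 0 < s0 <= 1 / 2 & forall x s, 0 <= s <= s0 ->
    last_coord x = 0 -> dot x x <= s ^+ 10 -> phi x <= C * s ^+ 6].
Proof.
move=> a5 [P /polynomial_function1_affine[p Pp]] /eqO_exP[k k0].
rewrite near_withinE => /nbhs_ballP[e /= e0 eP] phi0 grad0.
have flat x : last_coord x = 0 -> dot x x < 1 -> half_ball_boundary R m x.
  move=> x0 x1; apply: half_ball_boundaryP; first by apply: flat_closure; lra.
  by move=> /half_ballE[_]; rewrite x0 ltxx.
have dot00 : dot (0 : 'rV[R]_m.+1) 0 = 0 by exact: dot0l.
pose s0 := Num.min (1 / 2) (e / 2).
have near0 x s : 0 <= s <= s0 -> last_coord x = 0 -> dot x x <= s ^+ 10 ->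
    `|phi x - P x| <= k * s ^+ 6.
  rewrite le_min => /andP[sge0 /andP[s1 se]] x0 xs.
  have s5 : s ^+ 5 <= s by rewrite exprS ler_piMr// exprn_ile1//; lra.
  have s10 : s ^+ 10 = (s ^+ 5) ^+ 2 by ring.
  have xs5 : enorm x <= s ^+ 5 by rewrite enorm_le ?exprn_ge0// -s10.
  have := eP x; rewrite /= subr0 => /(_ _ _)/le_trans -> //.
  - split=> // i j; rewrite ord1 /ball /= mxE sub0r normrN.
    have : `|x 0 j| <= s ^+ 5.
      by rewrite -ler_sqr ?nnegrE ?exprn_ge0// -s10 -normrX ger0_norm ?sqr_ge0//
        (le_trans (coord_le_dot x j)).
    by move=> /le_lt_trans; apply; lra.
  - apply: flat => //; rewrite (le_lt_trans xs)// s10 expr_lt1 ?exprn_ge0//; lra.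
  rewrite ler_pM2l// ger0_norm ?powR_ge0//; apply: powR_le_expr6 => //; last lra.
  by rewrite xs5 sqrtr_ge0.
have s00 : 0 < s0 by rewrite lt_min; lra.
have P0 : P 0 = 0.
  have : `|phi 0 - P 0| <= k * 0 ^+ 6.
    by apply: near0; [lra | rewrite /last_coord mxE | rewrite dot00 expr0n].
  by rewrite phi0 sub0r normrN expr0n mulr0 normr_le0 => /eqP.
(* The tangential part of the gradient [p] of [P] vanishes. Otherwise, with [2 * d = |p_i|], at
   distance [s ^+ 5] along [e_i] the value of [|P|] is [2 * d * s ^+ 5], while [|phi| < d * s ^+ 5]
   by the zero derivative and [|phi - P| <= k * s ^+ 6 <= d * s ^+ 5]. *)
have pflat x : last_coord x = 0 -> dot p x = 0.
  move=> x0; rewrite /dot big1// => i _.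
  have [->|im] := eqVneq i ord_max; first by rewrite -/(last_coord x) x0 mulr0.
  suff -> : p 0 i = 0 by rewrite mul0r.
  have [j ij] : exists j : 'I_m, i = lift ord_max j.
    by case: (unliftP ord_max i) im => [j ->|->]; [exists j | rewrite eqxx].
  have gradi := grad0 j; rewrite -ij in gradi.
  have := @ex_derive _ _ _ _ _ _ _ gradi.
  rewrite /derivable; set g := (X in cvg (X @ _)) => cg.
  have glim := @derive_val _ _ _ _ _ _ _ gradi; rewrite /derive -/g in glim.
  have : g @ 0^' --> (0 : R^o) by rewrite -[X in _ --> X]glim.
  apply: contraPeq => pi0 /cvgrPdist_lt.
  have d0 : 0 < `|p 0 i| / 2 by rewrite divr_gt0// normr_gt0.
  set d := `|p 0 i| / 2 in d0 *.
  move=> /(_ _ d0)/nbhs_ballP[e1 /= e10 ge1].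
  pose s := Num.min s0 (Num.min (e1 / 2) (d / k)).
  have [s_gt0 ss0 se1 sd] : [/\ 0 < s, s <= s0, s < e1 & k * s <= d].
    split.
    - by rewrite lt_min s00 lt_min (divr_gt0 e10)// (divr_gt0 d0 k0).
    - by rewrite ge_min lexx.
    - by rewrite !gt_min; apply/orP; right; apply/orP; left; lra.
    - by rewrite mulrC -ler_pdivlMr// !ge_min lexx !orbT.
  have s1 : s <= 1 / 2 by rewrite (le_trans ss0)// ge_min lexx.
  have h0 : 0 < s ^+ 5 by rewrite exprn_gt0.
  have h1 : s ^+ 5 <= s by rewrite exprS ler_piMr ?exprn_ile1//; lra.
  pose y : 'rV[R]_m.+1 := s ^+ 5 *: delta_mx 0 i.
  have ynear : `|phi y - P y| <= k * s ^+ 6.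
    apply: near0; first by rewrite ltW.
      by rewrite /last_coord !mxE eq_sym (negPf im) andbF mulr0.
    by rewrite dotZZ dot_delta mxE !eqxx mulr1 -exprM.
  have := ge1 (s ^+ 5); rewrite /ball /= sub0r normrN gtr0_norm// (le_lt_trans h1)//.
  move=> /(_ isT (lt0r_neq0 h0)); rewrite sub0r normrN /g /= addr0 phi0 subr0 -/y.
  rewrite normrM normrV ?unitfE ?gt_eqF// gtr0_norm// ltr_pdivrMl//.
  have Py : P y = s ^+ 5 * p 0 i.
    rewrite Pp P0 add0r dotZr (_ : dot p _ = p 0 i)// -dot_delta.
    by apply: eq_bigr => ? _; rewrite mulrC.
  move=> hphi; have : `|P y| <= `|phi y| + k * s ^+ 6.
    by rewrite -[P y](subrK (phi y)) addrC (le_trans (ler_normD _ _))// lerD2l distrC.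
  rewrite Py normrM gtr0_norm// (_ : `|p 0 i| = 2 * d); last by rewrite /d; lra.
  by rewrite (_ : s ^+ 6 = s ^+ 5 * s) ?exprSr//; nra.
exists k, s0; split=> //; first by rewrite s00 ge_min lexx.
move=> x s ss0 x0 xs; have := near0 x s ss0 x0 xs.
by rewrite Pp P0 (pflat _ x0) !addr0 subr0; apply: le_trans; exact: ler_norm.
Qed.

(** The height reached on the axis when a point at height [s ^+ m.+2] is tilted with parameter
    [s ^+ m.+3]. *)
Lemma exprM5D {R : pzSemiRingType} (s : R) (m : nat) :
  s ^+ (6 * m + 17) = (s ^+ m.+3) ^+ 5 * s ^+ m.+2.
Proof. by rewrite -exprM -exprD; congr (_ ^+ _); lia. Qed.

(** * Barriers, normal slope and decay along the axis *)

Section BoundaryEstimate.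
Context {R : realType} {m : nat}.
Local Notation E := 'rV[R]_m.+1.
Local Notation HB := (half_ball R m).
Context (u f : E -> R) (L mu rho C0 s1 : R).
Context (cvx : convex_function (closure HB) u)
  (cont : {within closure HB, continuous u})
  (MA : alexandrov_solution HB u f)
  (fL : forall x, HB x -> 0 <= f x <= L)
  (bdry : forall x : E, closure HB x -> ~ HB x -> last_coord x <= rho ->
    mu * dot x x <= u x)
  (u0 : u 0 = 0)
  (flat : forall (x : E) (s : R), 0 <= s <= s1 -> last_coord x = 0 ->
    dot x x <= s ^+ 10 -> u x <= C0 * s ^+ 6).

(** Comparison with the paraboloid of coefficient [A] in the [m] tangential directions and [B] in
    the normal one; [dot x x - last_coord x ^+ 2] is [|x'|^2]. *)
Lemma half_ball_comparison (S : set E) (A B N : R) :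
  open S -> S `<=` HB -> 0 < A -> 0 < B -> L < (2 * A) ^+ m * (2 * B) ->
  (forall x, closure S x -> ~ S x ->
    A * (dot x x - last_coord x ^+ 2) + B * last_coord x ^+ 2 + N * last_coord x
      <= u x) ->
  forall x, S x ->
    A * (dot x x - last_coord x ^+ 2) + B * last_coord x ^+ 2 + N * last_coord x
      <= u x.
Proof.
move=> oS SHB A0 B0 LAB bd.
pose c (i : 'I_m.+1) := if i == ord_max then B else A.
pose b (i : 'I_m.+1) := if i == ord_max then N else 0.
have wE x : diag_quad c b x =
    A * (dot x x - last_coord x ^+ 2) + B * last_coord x ^+ 2 + N * last_coord x.
  rewrite dot_lastE addrK /diag_quad (bigD1 ord_max)//= /c /b eqxx mulr_sumr.
  rewrite [LHS]addrC -[RHS]addrA; congr (_ + _).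
  by apply: eq_bigr => i /negPf ->; rewrite mul0r addr0.
have c0 i : 0 < c i by rewrite /c; case: ifP.
have Lc : L < \prod_i (2 * c i).
  rewrite (bigD1 ord_max)//= /c eqxx mulrC (eq_bigr (fun=> 2 * A)) => [|i /negPf -> //].
  by rewrite prodr_const cardC1 card_ord.
have bd' x : closure S x -> ~ S x -> diag_quad c b x <= u x.
  by rewrite wE; exact: bd.
move=> x Sx; rewrite -wE.
exact: (alexandrov_comparison _ _ _ _ _ _ _ compact_closure_half_ball oS SHB
  cont cvx MA fL c0 Lc bd').
Qed.

Lemma closure_not_half_ball x : closure HB x -> ~ HB x ->
  last_coord x = 0 \/ dot x x = 1.
Proof.
move=> /closure_half_ball[x1 x0] nx.
have [xn|xn] := leP (last_coord x) 0; first by left; lra.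
have [d1|d1] := ltP (dot x x) 1; last by right; lra.
by case: nx; apply/half_ballE.
Qed.

Lemma coord_le1 x : closure HB x -> last_coord x <= 1.
Proof.
move=> /closure_half_ball[x1 _].
by have := coord_le_dot x ord_max; rewrite -/(last_coord x); nra.
Qed.

(** Compare [u] on the whole half ball with [mu / 2 * |x'|^2 + K * x_n^2 - N * x_n]: a large [K]
    makes its Hessian determinant exceed [L], a large [N] puts it below [u] on the boundary. The [K]
    term is dropped at the end. *)
Lemma lower_barrier : 0 < mu -> 0 < rho -> exists2 N, 0 < N & forall x, closure HB x ->
  last_coord x <= rho ->
  mu / 2 * (dot x x - last_coord x ^+ 2) - N * last_coord x <= u x.
Proof.
move=> mu0 rho0; have L0 : 0 <= L.
  have hx : HB (axis (1 / 2)).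
    by apply/half_ballE; rewrite dot_axis last_coord_axis; lra.
  by case/andP: (fL _ hx) => /le_trans; exact.
have [||xm /set_mem _ minu] := @EVT_min_rV _ _ u _ _ compact_closure_half_ball.
- by exists 0; apply: flat_closure; rewrite ?dot0l// /last_coord mxE.
- exact: cont.
have mum : 0 < mu ^+ m by rewrite exprn_gt0.
have [K K0 LK] : exists2 K : R, 0 < K & L < mu ^+ m * (2 * K).
  exists ((L + 1) / (2 * mu ^+ m)); first by rewrite divr_gt0 ?mulr_gt0//; lra.
  rewrite (_ : _ * _ = L + 1); first lra.
  by field; rewrite gt_eqF.
have [V V0 uV] : exists2 V : R, 0 <= V & forall x, closure HB x -> - V <= u x.
  exists `|u xm| => // x cx; apply: le_trans (minu _ (mem_set cx)).
  by rewrite lerNl -normrN ler_norm.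
(* The first bound absorbs [K * x_n^2] into [N * x_n], since [x_n <= 1]; the second pushes the
   barrier below [- V <= u] at boundary points higher than [rho]. *)
have [N NK Nrho] : exists2 N : R, K <= N & mu / 2 + K + V <= N * rho.
  have M0 : 0 <= mu / 2 + K + V by lra.
  exists (K + (mu / 2 + K + V) / rho).
    by rewrite lerDl divr_ge0// ltW.
  by rewrite mulrDl divfK ?gt_eqF// lerDr mulr_ge0// ltW.
exists N; first lra.
move=> x cx xr; have [xHB|xHB] := pselect (HB x); last first.
  have [x1 x0] := closure_half_ball x cx.
  have := bdry _ cx xHB xr; have := coord_le_dot x ord_max; rewrite -/(last_coord x).
  have : 0 <= N * last_coord x by rewrite mulr_ge0//; lra.
  have := dot_ge0 x; nra.
have h : mu / 2 * (dot x x - last_coord x ^+ 2) + K * last_coord x ^+ 2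
    + - N * last_coord x <= u x.
  apply: (half_ball_comparison HB) => //.
  - exact: open_half_ball.
  - lra.
  - by rewrite (_ : 2 * (mu / 2) = mu)//; lra.
  move=> y cy yHB; have [y1 y0] := closure_half_ball y cy.
  have yle := coord_le1 _ cy.
  have d1 := coord_le_dot y ord_max; rewrite -/(last_coord y) in d1.
  have KN : K * last_coord y ^+ 2 <= N * last_coord y.
    by rewrite expr2 mulrA ler_wpM2r// (le_trans _ NK)// ler_piMr// ltW.
  have [yr|yr] := leP (last_coord y) rho; first by have := bdry _ cy yHB yr; nra.
  have := uV y cy; nra.
have : 0 <= K * last_coord x ^+ 2 by rewrite mulr_ge0 ?sqr_ge0 ?(ltW K0).
lra.
Qed.

(* Join [x] to the boundary point opposite to it, so that the segment meets
   the axis at height [s ^+ 5 * last_coord x]. *)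
Lemma tilt x s : 0 < C0 -> s1 <= 1 / 2 -> closure HB x -> 0 <= s <= s1 / 2 ->
  u (axis (s ^+ 5 * last_coord x)) <= s ^+ 5 * u x + 64 * C0 * s ^+ 6.
Proof.
move=> C00 s12 cx /andP[s_ge0 ss1]; have [x1 x0] := closure_half_ball x cx.
pose th := s ^+ 5.
have th0 : 0 <= th by rewrite exprn_ge0.
have th2 : th <= 1 / 4.
  have -> : th = s * s ^+ 4 by rewrite -exprS.
  have : s ^+ 4 <= 1 by rewrite exprn_ile1//; lra.
  by have : 0 <= s ^+ 4 by [rewrite exprn_ge0]; nra.
(* The factor cancels the tangential part in [th *: x + (1 - th) *: y]. *)
pose y : E := (- (th / (1 - th))) *: tangential x.
have y0 : last_coord y = 0.
  by rewrite /last_coord mxE -/(last_coord _) last_coord_tangential mulr0.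
have yd : dot y y <= 4 * th ^+ 2.
  rewrite dotZZ sqrrN dot_tangential.
  have : dot x x - last_coord x ^+ 2 <= 1.
    by have := sqr_ge0 (last_coord x); lra.
  have : 0 <= dot x x - last_coord x ^+ 2.
    by have := coord_le_dot x ord_max; rewrite -/(last_coord x); lra.
  have : 0 <= th / (1 - th) <= 2 * th.
    by rewrite divr_ge0//= ?ler_pdivrMr; nra.
  move: (th / (1 - th)) => a; nra.
(* Since [|y| <= 2 * s ^+ 5 <= (2 * s) ^+ 5], the flat bound is used at [2 * s <= s1]; its sixth
   power is the origin of 64. *)
have uy : u y <= C0 * (2 * s) ^+ 6.
  apply: flat => //; first lra.
  rewrite (le_trans yd)// (_ : (2 * s) ^+ 10 = 1024 * th ^+ 2) ?ler_wpM2r ?sqr_ge0//.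
    by lra.
  by rewrite /th; ring.
have cy : closure HB y by apply: flat_closure; [nra | rewrite y0].
have -> : axis (th * last_coord x) = th *: x + (1 - th) *: y.
  rewrite /y scalerA mulrN mulrCA divff ?mulr1; last by rewrite gt_eqF; lra.
  by rewrite scaleNr -scalerBr /tangential opprB addrC subrK scalerA.
have := convex_functionP x y th cvx cx cy; rewrite th0 => /(_ _)/le_trans -> //.
  lra.
rewrite lerD2l; apply: le_trans (_ : (1 - th) * (C0 * (2 * s) ^+ 6) <= _).
  by rewrite ler_wpM2l//; lra.
rewrite (_ : C0 * (2 * s) ^+ 6 = 64 * C0 * s ^+ 6); last by ring.
by rewrite ler_piMl ?mulr_ge0 ?exprn_ge0//; lra.
Qed.
Lemma axis_in_half_ball t : 0 < t < 1 -> HB (axis t).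
Proof. by move=> t01; apply/half_ballE; rewrite dot_axis last_coord_axis; nra. Qed.

Lemma half_ball_closure0 : closure HB 0.
Proof. by apply: flat_closure; rewrite ?dot0l// /last_coord mxE. Qed.

(** The slope [a] is the infimum of [u (axis t) / t] over [0 < t <= r], finite because the lower
    barrier bounds these quotients below by [- N]. *)
Lemma normal_slope : 0 < mu -> 0 < rho -> exists a r : R,
  [/\ 0 < r <= 1 / 2, forall t, 0 < t <= r -> a * t <= u (axis t) &
    forall e, 0 < e -> exists2 t, 0 < t <= r & u (axis t) < (a + e) * t].
Proof.
move=> mu0 rho0; have [N N0 barrier] := lower_barrier mu0 rho0.
pose r := Num.min rho (1 / 2).
have [r0 r12 rrho] : [/\ 0 < r, r <= 1 / 2 & r <= rho].
  by rewrite /r lt_min !ge_min !lexx orbT rho0 divr_gt0.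
pose Q := [set u (axis t) / t | t in [set t | 0 < t <= r]].
have lbQ : lbound Q (- N).
  move=> _ [t /andP[t0 tr] <-]; rewrite ler_pdivlMr//.
  have := barrier (axis t); rewrite last_coord_axis dot_axis subrr mulr0 sub0r.
  rewrite mulNr; apply; last by lra.
  by apply/subset_closure/axis_in_half_ball; lra.
have infQ : has_inf Q.
  by split; [exists (u (axis r) / r), r; rewrite //= r0 lexx | exists (- N)].
exists (inf Q), r; split=> [|t tr|e e0]; first by rewrite r0.
  have /andP[t0 _] := tr; rewrite -ler_pdivlMr//; apply: ge_inf; first exact: infQ.2.
  by exists t.
have [_ [t tr <-]] := inf_adherent e0 infQ.
by have /andP[t0 _] := tr; rewrite ltr_pdivrMr//; exists t.
Qed.

(** If [u x < a * x_n], tilting [x] onto the axis at height [s ^+ 5 * x_n] costs only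
    [64 * C0 * s ^+ 6]. For small [s] this is less than the deficit [s ^+ 5 * (a * x_n - u x)], so
    [u] would fall below slope [a] on the axis. *)
Lemma normal_slope_le a r : 0 < mu -> 0 < rho -> 0 < C0 -> 0 < s1 <= 1 / 2 ->
  0 < r -> (forall t, 0 < t <= r -> a * t <= u (axis t)) ->
  forall x, closure HB x -> a * last_coord x <= u x.
Proof.
move=> mu0 rho0 C00 /andP[s10 s12] r0 ar x cx.
have [x1 x0] := closure_half_ball x cx; have xle := coord_le1 x cx.
have [xz|xn] := eqVneq (last_coord x) 0.
  have nx : ~ HB x by move=> /half_ballE[_]; rewrite xz ltxx.
  rewrite xz mulr0 (le_trans _ (bdry _ cx nx _)) ?xz ?(ltW rho0)//.
  by rewrite mulr_ge0 ?dot_ge0 ?ltW.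
have xgt0 : 0 < last_coord x by rewrite lt_neqAle eq_sym xn.
rewrite leNgt; apply/negP => ux.
have d0 : 0 < (a * last_coord x - u x) / (128 * C0) by rewrite divr_gt0; lra.
pose s := Num.min (Num.min (s1 / 2) r) ((a * last_coord x - u x) / (128 * C0)).
have [s0 ss1 sr sd] : [/\ 0 < s, s <= s1 / 2, s <= r &
    s <= (a * last_coord x - u x) / (128 * C0)].
  by rewrite /s !lt_min !ge_min !lexx ?orbT d0 r0 divr_gt0.
have s5 : s ^+ 5 <= s by rewrite exprS ler_piMr ?exprn_ile1//; lra.
have s50 : 0 < s ^+ 5 by rewrite exprn_gt0.
have xr : 0 < s ^+ 5 * last_coord x <= r.
  by rewrite mulr_gt0//= (le_trans (ler_piMr _ _))//; lra.
have ss : 0 <= s <= s1 / 2 by rewrite ltW.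
have := le_trans (ar _ xr) (tilt x s C00 s12 cx ss).
apply/negP; rewrite -ltNge (_ : s ^+ 6 = s ^+ 5 * s); last by rewrite -exprSr.
rewrite (_ : _ + _ = s ^+ 5 * (u x + 64 * C0 * s)); last by ring.
rewrite mulrCA ltr_pM2l//; move: sd; rewrite ler_pdivlMr; lra.
Qed.

(* Otherwise a paraboloid whose slope along the axis exceeds [a] lies below [u]
   in the slab [last_coord x < s ^+ m.+2]. *)
Lemma low_points a r : 0 < mu -> 0 < rho -> 0 <= L -> r <= 1 / 2 ->
  (forall e, 0 < e -> exists2 t, 0 < t <= r & u (axis t) < (a + e) * t) ->
  exists2 s0, 0 < s0 <= 1 & forall s, 0 < s <= s0 -> exists y,
    [/\ closure HB y, last_coord y = s ^+ m.+2 &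
      u y <= a * s ^+ m.+2 + s ^+ m.+3].
Proof.
move=> mu0 rho0 L0 r12 slope; have [N N0 barrier] := lower_barrier mu0 rho0.
have [N' N'1 NN'] : exists2 N' : R, 1 <= N' & N + a <= N'.
  by exists (N + `|a| + 1); have := ler_norm a; have := normr_ge0 a; lra.
have [b b0 ab] : exists2 b : R, 0 <= b & a <= b by exists `|a|; rewrite ?ler_norm.
have D0 : 0 < (mu / (4 * N')) ^+ m by rewrite exprn_gt0// divr_gt0; lra.
(* The bound by [rho] keeps the slab where the barrier and the boundary growth hold; the third bound
   serves on the spherical part of the boundary, the fourth makes the Hessian determinant exceed
   [L]. *)
pose s0 := Num.min (Num.min 1 rho)
  (Num.min (mu / (mu + b + 2)) ((mu / (4 * N')) ^+ m / (4 * (L + 1)))).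
have M0 : 0 < mu / (mu + b + 2) by rewrite divr_gt0; lra.
have DL0 : 0 < (mu / (4 * N')) ^+ m / (4 * (L + 1)) by rewrite divr_gt0; lra.
exists s0; first by rewrite /s0 !lt_min !ge_min lexx rho0 M0 DL0 ltr01.
move=> s /andP[s_gt0]; rewrite !le_min => /andP[/andP[s1le srho] /andP[sM sD]].
have {}sM : s * (mu + b + 2) <= mu by move: sM; rewrite ler_pdivlMr; lra.
have {}sD : s * (4 * (L + 1)) <= (mu / (4 * N')) ^+ m.
  by move: sD; rewrite ler_pdivlMr; lra.
apply: contrapT => noy.
pose p := s ^+ m.+1.
have p0 : 0 < p by rewrite exprn_gt0.
have p1 : p <= 1 by rewrite exprn_ile1// ltW.
have etaE : s ^+ m.+2 = s * p by rewrite exprS.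
have hE : s ^+ m.+3 = s * (s * p) by rewrite 2!exprS.
rewrite etaE hE in noy.
have eta0 : 0 < s * p by rewrite mulr_gt0.
have etas : s * p <= s by rewrite ler_piMr// ltW.
have high y : closure HB y -> last_coord y = s * p ->
    a * (s * p) + s * (s * p) < u y.
  by move=> cy yp; rewrite ltNge; apply/negP => uy; apply: noy; exists y.
(* With [eta = s * p] and [h = s * eta], [B * eta^2 = h / 4], and [A] is [mu / 2] times the weight
   [s / (4 * N')] used on the top slice. The Hessian determinant is
   [(mu / (4 * N')) ^+ m / (2 * s)]. *)
pose A := mu * s / (8 * N'); pose B := 1 / (4 * p).
pose S := HB `&` [set x | last_coord x < s * p].
have oS : open S.
  apply: openI; first exact: open_half_ball.
  have := @open_comp _ _ (@last_coord R m) [set t | t < s * p].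
  by apply => // x _; exact: last_coord_continuous.
have A0 : 0 < A by rewrite divr_gt0// ?mulr_gt0//; lra.
have B0 : 0 < B by rewrite divr_gt0// mulr_gt0.
have LAB : L < (2 * A) ^+ m * (2 * B).
  have -> : (2 * A) ^+ m * (2 * B) = (mu / (4 * N')) ^+ m / (2 * s).
    rewrite (_ : 2 * A = mu / (4 * N') * s); last by rewrite /A; field; lra.
    by rewrite exprMn /B /p exprS; field; rewrite expf_neq0 gt_eqF.
  by rewrite ltr_pdivlMr; nra.
have Bp : B * (s * p) ^+ 2 = s * (s * p) / 4 by rewrite /B; field; rewrite gt_eqF.
have bd x : closure S x -> ~ S x ->
    A * (dot x x - last_coord x ^+ 2) + B * last_coord x ^+ 2
      + (a + s / 4) * last_coord x <= u x.
  have ScHB : closure S x -> closure HB x by apply: closure_subset; exact: subIsetl.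
  have Seta : closure S x -> last_coord x <= s * p.
    have clE : closed [set x : E | last_coord x <= s * p].
      have := @closed_comp _ _ (@last_coord R m) [set t | t <= s * p].
      by apply => // y _; exact: last_coord_continuous.
    move=> cx; suff : [set x : E | last_coord x <= s * p] x by [].
    rewrite ((closure_id _).1 clE); apply: closure_subset cx => y [_ /= yp].
    exact: ltW.
  move=> cSx nSx; have cx := ScHB cSx; have xeta := Seta cSx.
  have [x1 x0] := closure_half_ball x cx.
  have T0 : 0 <= dot x x - last_coord x ^+ 2.
    by rewrite subr_ge0; exact: coord_le_dot.
  have Bx : B * last_coord x ^+ 2 <= s * (s * p) / 4.
    by rewrite -Bp ler_pM2l// ler_sqr ?nnegrE// ltW.
  have Amu : A <= mu / 8 * s.
    by rewrite /A ler_pdivrMr; last lra; have := mulr_gt0 mu0 s_gt0; nra.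
  have [xe|xne] := eqVneq (last_coord x) (s * p).
    have hx := high x cx xe; have bx := barrier x cx (le_trans xeta (le_trans etas srho)).
    rewrite xe in bx *; rewrite Bp.
    move: (dot x x - (s * p) ^+ 2) bx => T bx.
    (* On the top slice, average the barrier with weight [sg] and the bound [high] with weight
       [1 - sg]. The losses [sg * (N + a) * eta] and [sg * h] are each at most [h / 4], leaving
       [h / 2]: half for [B * eta^2], half for [s / 4 * eta]. *)
    pose sg := s / (4 * N').
    have sg0 : 0 <= sg by rewrite divr_ge0; lra.
    have sg1 : sg <= 1 / 4 by rewrite ler_pdivrMr; lra.
    have sgN : sg * N' = s / 4 by rewrite /sg; field; lra.
    have AE : A = sg * (mu / 2) by rewrite /A /sg; field; lra.
    rewrite AE.
    have := ler_wpM2l sg0 bx.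
    have sg1' : 0 <= 1 - sg by lra.
    have := ler_wpM2l sg1' (ltW hx).
    have : sg * (N + a) * (s * p) <= s / 4 * (s * p).
      by rewrite ler_wpM2r ?(ltW eta0)// -sgN ler_wpM2l.
    have : sg * (s * (s * p)) <= 1 / 4 * (s * (s * p)).
      by rewrite ler_wpM2r// mulr_ge0// ltW.
    move: (s * p) => q; lra.
  have nx : ~ HB x by move=> hx; apply: nSx; split => //=; rewrite lt_neqAle xne.
  have ux := bdry x cx nx (le_trans xeta (le_trans etas srho)).
  have [xz|d1] := closure_not_half_ball x cx nx.
    rewrite xz expr0n !mulr0 subr0 !addr0 (le_trans _ ux)// ler_wpM2r ?dot_ge0//.
    by have : mu * s <= mu by [rewrite ler_piMr// ltW]; lra.
  (* On the sphere [u >= mu], while every term of the paraboloid is of order [s]. *)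
  rewrite d1 mulr1 in ux; apply: le_trans ux; rewrite d1.
  have : A * (1 - last_coord x ^+ 2) <= A by rewrite ler_piMr ?(ltW A0)// gerBl sqr_ge0.
  have : (a + s / 4) * last_coord x <= (b + s / 4) * s.
    apply: (@le_trans _ _ ((b + s / 4) * last_coord x)).
      by rewrite ler_wpM2r// lerD2r.
    by rewrite ler_wpM2l ?(le_trans xeta)//; lra.
  have : s * (s * p) <= s * 1 by rewrite ler_wpM2l ?(ltW s_gt0)//; lra.
  have : s * s <= s * 1 by rewrite ler_wpM2l ?(ltW s_gt0).
  have := mulr_ge0 b0 (ltW s_gt0); have := mulr_gt0 mu0 s_gt0.
  move: sM Bx Amu; move: (B * _) (A * _) (s * (s * p)) => z1 z2 z3; lra.
have below := half_ball_comparison S A B (a + s / 4) oS (@subIsetl _ _ _) A0 B0 LAB bd.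
(* Some axis point has slope below [a + s / 4]. Contracting it towards 0 into the slab keeps this by
   convexity, against the paraboloid bound. *)
have [|t /andP[t0 tr] ut] := slope (s / 4); first by rewrite divr_gt0.
have tau : 0 <= s * p / 2 <= 1 by lra.
have tHB : HB (axis t) by apply: axis_in_half_ball; lra.
have := convex_functionP (axis t) 0 (s * p / 2) cvx (subset_closure tHB)
  half_ball_closure0 tau.
rewrite scaler0 addr0 u0 mulr0 addr0 /axis scalerA -/(axis _) => h.
have St : S (axis (s * p / 2 * t)).
  by split; [apply: axis_in_half_ball; nra | rewrite /= last_coord_axis; nra].
have := below _ St; rewrite dot_axis last_coord_axis subrr mulr0 add0r.
have : 0 <= B * (s * p / 2 * t) ^+ 2 by rewrite mulr_ge0 ?sqr_ge0 ?ltW.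
move: h; rewrite -/(axis t); nra.
Qed.

(** Tilt the low point with parameter [s ^+ m.+3]. Its excess over slope [a], scaled by
    [(s ^+ m.+3) ^+ 5], and the tilting error both have order [s ^+ (6 * m + 18)], one power of [s]
    beyond the height. *)
Lemma axis_decay a r : 0 < mu -> 0 < rho -> 0 <= L -> 0 < C0 -> 0 < s1 <= 1 / 2 ->
  r <= 1 / 2 ->
  (forall e, 0 < e -> exists2 t, 0 < t <= r & u (axis t) < (a + e) * t) ->
  exists2 s0, 0 < s0 <= 1 & forall s, 0 < s <= s0 ->
    u (axis (s ^+ (6 * m + 17))) <=
      a * s ^+ (6 * m + 17) + (1 + 64 * C0) * s ^+ (6 * m + 18).
Proof.
move=> mu0 rho0 L0 C00 /andP[s10 s12] r12 slope.
have [s0 /andP[s00 s01] low] := low_points a r mu0 rho0 L0 r12 slope.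
exists (Num.min s0 (s1 / 2)).
  by rewrite lt_min s00 divr_gt0//= ge_min s01.
move=> s; rewrite le_min => /andP[s_gt0 /andP[ss0 ss1]].
have [|y [cy yE uy]] := low s; first by rewrite s_gt0.
have sq : 0 <= s ^+ m.+3 <= s1 / 2.
  rewrite exprn_ge0 ?(ltW s_gt0)//=; apply: le_trans ss1.
  by rewrite exprS ler_piMr ?exprn_ile1//; lra.
have := tilt y (s ^+ m.+3) C00 s12 cy sq.
rewrite yE.
pose b := (s ^+ m.+3) ^+ 5; pose c := s ^+ m.+2; pose d := s ^+ m.+3.
have e1 : s ^+ (6 * m + 17) = b * c by exact: exprM5D.
have e2 : s ^+ (6 * m + 18) = b * d.
  by rewrite (addnS _ 17) exprS e1 mulrCA /d exprS.
have e3 : (s ^+ m.+3) ^+ 6 = b * d by rewrite /b /d -exprSr.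
rewrite e1 e2 e3 => /le_trans; apply.
have b0 : 0 <= b by rewrite !exprn_ge0// ltW.
rewrite -/b; have := ler_wpM2l b0 uy.
rewrite -/c -/d; move: b c d (u y) {e1 e2 e3 b0 uy sq} => b c d v; lra.
Qed.
End BoundaryEstimate.

(** * From the axis to the full pointwise estimate *)

Lemma root_powR {R : realType} (b : R) (k : nat) : 0 <= b ->
  (b `^ (k.+1%:R^-1)) ^+ k.+1 = b.
Proof.
by move=> b0; rewrite -powR_mulrn ?powR_ge0// -powRrM mulVf ?powRr1// pnatr_eq0.
Qed.

Lemma pointwise_holder1_last_coord {R : realType} {m : nat} (D : set 'rV[R]_m.+1)
    (u : 'rV[R]_m.+1 -> R) (a al C d : R) :
  0 < C -> 0 < d -> 0 <= al ->
  (forall x, D x -> dot x x < d ->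
    `|u x - a * last_coord x| <= C * (enorm x * enorm x `^ al)) ->
  pointwise_holder 1 al D u 0.
Proof.
move=> C0 d0 al0 uC; exists (fun x => a * last_coord x).
  exact: coord_polynomial.
apply/eqO_exP; exists C => //; rewrite near_withinE.
have : nbhs (0 : 'rV[R]_m.+1) [set x | dot x x < d].
  apply: open_nbhs_nbhs; split; last by rewrite /= dot0l.
  have := @open_comp _ _ (fun x : 'rV[R]_m.+1 => dot x x) [set r | r < d].
  by apply => // x _; exact: dot_self_continuous.
apply: filterS => x /= xd Dx; rewrite subr0 [X in _ <= _ * X]ger0_norm ?powR_ge0//.
rewrite powRD ?powRr1 ?sqrtr_ge0//; first exact: uC.
by apply/implyP => /eqP; lra.
Qed.

Lemma midpoint_tangential_axis {R : realType} {m : nat} (x : 'rV[R]_m.+1) :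
  (1 / 2) *: (2 *: tangential x) + (1 - 1 / 2) *: axis (2 * last_coord x) = x.
Proof.
have e1 : 1 / 2 * 2 = 1 :> R by lra.
have e2 : (1 - 1 / 2) * (2 * last_coord x) = last_coord x by lra.
by rewrite /axis !scalerA e1 e2 scale1r subrK.
Qed.

(* The dimension is n = m.+1, and x_n is the last coordinate. *)
Theorem theorem1p3 (R : realType) (m : nat) (hn : (2 <= m.+1)%N)
    (alpha : R) (halpha : 1 / 5 < alpha <= 1) :
  exists alpha' : R, 0 < alpha' <= 1 /\
    forall (lambda Lambda : R) (u phi f : 'rV[R]_m.+1 -> R),
      0 < lambda <= Lambda ->
      convex_function (closure (half_ball R m)) u ->
      {within closure (half_ball R m), continuous u} ->
      alexandrov_solution (half_ball R m) u f ->
      (forall x, half_ball_boundary R m x -> u x = phi x) ->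
      (forall x, half_ball R m x -> lambda <= f x <= Lambda) ->
      pointwise_holder 1 alpha (half_ball_boundary R m) phi 0 ->
      phi 0 = 0 ->
      tangential_gradient0 phi ->
      (exists mu rho : R, [/\ 0 < mu, 0 < rho &
        forall x, half_ball_boundary R m x -> last_coord x <= rho ->
          mu * enorm x ^+ 2 <= phi x]) ->
      pointwise_holder 1 alpha' (closure (half_ball R m)) u 0.
Proof.
have /andP[alpha5 _] := halpha.
(* At height [s ^+ (6 * m + 17)] the decay gains one factor [s], the power [1 / (6 * m + 17)] of the
   height. *)
exists ((6 * m + 17)%:R^-1); split.
  by rewrite invr_gt0 ltr0n invf_le1 ?ltr0n ?ler1n addnS.
move=> lambda L u phi f /andP[lam0 lamL] cvx cont MA uphi fb phiH phi0 gphi.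
move=> [mu [rho [mu0 rho0 sep]]].
have [C0 [s1 [C00 s1P flatphi]]] := flat_boundary_bound alpha phi alpha5 phiH phi0 gphi.
have /andP[s10 s12] := s1P.
have uB x : closure (half_ball R m) x -> ~ half_ball R m x -> u x = phi x.
  by move=> cx nx; apply/uphi/half_ball_boundaryP.
have u0 : u 0 = 0.
  have n0 : ~ half_ball R m 0 by move=> /half_ballE[_]; rewrite /last_coord mxE ltxx.
  by rewrite (uB 0 half_ball_closure0 n0).
have fL x : half_ball R m x -> 0 <= f x <= L by move=> /fb /andP[]; lra.
have L0 : 0 <= L by lra.
have bdry x : closure (half_ball R m) x -> ~ half_ball R m x ->
    last_coord x <= rho -> mu * dot x x <= u x.
  move=> cx nx xr; rewrite uB// -enormE2; apply: sep => //.
  exact: half_ball_boundaryP.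
have flat x s : 0 <= s <= s1 -> last_coord x = 0 -> dot x x <= s ^+ 10 ->
    u x <= C0 * s ^+ 6.
  move=> /andP[s0 ss] xz xs.
  have cx : closure (half_ball R m) x.
    apply: flat_closure; last by rewrite xz.
    by rewrite (le_lt_trans xs)// exprn_ilt1//; lra.
  have nx : ~ half_ball R m x by move=> /half_ballE[_]; rewrite xz ltxx.
  by rewrite (uB x cx nx); apply: flatphi => //; rewrite s0.
have [a [r [/andP[r0 r12] ar slope]]] :=
  normal_slope u f L mu rho cvx cont MA fL bdry mu0 rho0.
have ua := normal_slope_le u mu rho C0 s1 cvx bdry flat a r mu0 rho0 C00 s1P r0 ar.
have [s0 /andP[s00 s01] decay] :=
  axis_decay u f L mu rho C0 s1 cvx cont MA fL bdry u0 flat a r mu0 rho0 L0 C00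
    s1P r12 slope.
pose k := (6 * m + 16)%N.
have kE : (6 * m + 17)%N = k.+1 by rewrite /k addnS.
have kE' : (6 * m + 18)%N = k.+2 by rewrite addnS kE.
rewrite kE' in decay; rewrite kE in decay *.
have k5 : (5 <= k.+1)%N by rewrite /k -addnS; apply: leq_trans (leq_addl _ _).
pose al : R := k.+1%:R^-1; rewrite -/al.
have al0 : 0 <= al by rewrite invr_ge0.
pose C1 := 1 + 64 * C0; have C10 : 0 < C1 by rewrite /C1; lra.
pose e := Num.min (s1 ^+ 5) (Num.min (s0 ^+ k.+1) 1).
have e0 : 0 < e by rewrite /e lt_min exprn_gt0//= lt_min ltr01 exprn_gt0.
have e2 : 0 < (e / 2) ^+ 2 by rewrite exprn_gt0// divr_gt0.
apply: (pointwise_holder1_last_coord _ u a al ((C0 + C1) * 2 `^ al) _ _ e2) => //.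
  by rewrite mulr_gt0 ?powR_gt0// addr_gt0.
move=> x cx xe.
(* [x] is the midpoint of [2 *: tangential x] and [axis (2 * last_coord x)], both of norm at most
   [b]. Below, [b * t] is the power [1 + al] of [b]. *)
pose b := 2 * enorm x.
have N0 : 0 <= enorm x by exact: sqrtr_ge0.
have b0 : 0 <= b by rewrite mulr_ge0.
have be : b < e.
  move: xe; rewrite -enorm_lt ?divr_ge0 ?(ltW e0)// /b; lra.
have [bs1 bs0 b1] : [/\ b <= s1 ^+ 5, b <= s0 ^+ k.+1 & b < 1].
  by move: be; rewrite !lt_min => /andP[/ltW -> /andP[/ltW -> ->]].
pose t := b `^ al; have t0 : 0 <= t by exact: powR_ge0.
have tk : t ^+ k.+1 = b by exact: root_powR.
have [x1 x0] := closure_half_ball x cx.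
have d0 := coord_le_dot x ord_max; rewrite -/(last_coord x) in d0.
have xb : 2 * last_coord x <= b.
  rewrite ler_pM2l// -ler_sqr ?nnegrE// enormE2//.
have t1 : t <= 1 by rewrite -(ler_pXn2r (ltn0Sn k)) ?nnegrE// tk expr1n ltW.
have uflat : u (2 *: tangential x) <= C0 * (b * t).
  (* The flat bound gives [C0 * b * s]; as [b < 1] and [5 <= k.+1], the fifth root [s] is at most
     [t]. *)
  pose s := b `^ (5%:R^-1).
  have s5 : s ^+ 5 = b by exact: root_powR.
  have s_ge0 : 0 <= s by exact: powR_ge0.
  have ss1 : s <= s1 by rewrite -(ler_pXn2r (ltn0Sn 4)) ?nnegrE ?s5// ltW.
  have st : s <= t.
    rewrite -(ler_pXn2r (ltn0Sn 4)) ?nnegrE// s5 -tk.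
    exact: (ler_wiXn2l t0 t1).
  apply: (@le_trans _ _ (C0 * s ^+ 6)).
    apply: flat; first by rewrite s_ge0.
      by rewrite /last_coord mxE -/(last_coord _) last_coord_tangential mulr0.
    rewrite dotZZ dot_tangential (_ : s ^+ 10 = b ^+ 2); last by rewrite -s5 -exprM.
    by rewrite /b exprMn enormE2 ler_wpM2l ?sqr_ge0// gerBl sqr_ge0.
  by rewrite ler_pM2l// exprSr s5 ler_wpM2l.
have uaxis : u (axis (2 * last_coord x)) <= a * (2 * last_coord x) + C1 * (b * t).
  (* [decay] speaks of positive parameters only, so height 0 is treated apart. *)
  have [xz|xn] := eqVneq (last_coord x) 0.
    by rewrite xz !mulr0 add0r /axis scale0r u0 !mulr_ge0// ltW.
  have xp : 0 < 2 * last_coord x by rewrite mulr_gt0// lt_neqAle eq_sym xn.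
  pose v := (2 * last_coord x) `^ al.
  have v0 : 0 < v by exact: powR_gt0.
  have vk : v ^+ k.+1 = 2 * last_coord x by apply: root_powR; exact: ltW.
  have vs0 : v <= s0.
    by rewrite -(ler_pXn2r (ltn0Sn k)) ?nnegrE ?(ltW v0) ?(ltW s00)// vk (le_trans xb).
  have vt : v <= t.
    by rewrite -(ler_pXn2r (ltn0Sn k)) ?nnegrE ?(ltW v0)// vk tk.
  have := decay v; rewrite v0 vs0 vk => /(_ isT)/le_trans; apply.
  rewrite lerD2l -/C1 ler_pM2l// exprSr vk ler_pM// ltW//.
have half : 0 <= (1 / 2 : R) <= 1 by lra.
have cT : closure (half_ball R m) (2 *: tangential x).
  apply: flat_closure; last first.
    by rewrite /last_coord mxE -/(last_coord _) last_coord_tangential mulr0.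
  rewrite dotZZ dot_tangential -enormE2 mulrBr -exprMn -/b.
  by have := sqr_ge0 (last_coord x); nra.
have cA : closure (half_ball R m) (axis (2 * last_coord x)).
  by apply: flat_closure; rewrite ?dot_axis ?last_coord_axis; nra.
(* Convexity at the midpoint gives the upper bound; [ua] gives the lower bound 0 for
   [u x - a * last_coord x]. *)
have := convex_functionP (2 *: tangential x) (axis (2 * last_coord x)) (1 / 2)
  cvx cT cA half.
rewrite midpoint_tangential_axis => ux; rewrite ger0_norm ?subr_ge0 ?ua//.
have -> : (C0 + C1) * 2 `^ al * (enorm x * enorm x `^ al) = (C0 + C1) / 2 * (b * t).
  by rewrite /t /b powRM//; field.
lra.
Qed.
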